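(* Let $k$ be a field and let $\mathcal{C}$ be the category of diagrams $U\xrightarrow{\alpha}V\xrightarrow{\beta}W$ of $k$-vector spaces. Let $\mathcal{D}$ be the full subcategory of $\mathcal{C}$ consisting of those diagrams for which $V=\operatorname{im}\alpha+\ker\beta$. Then $\mathcal{D}$ is a preabelian category which is right integral, but it is neither left semi-abelian nor left integral.
   Context: Morphisms in $\mathcal{C}$ from $U\xrightarrow{\alpha}V\xrightarrow{\beta}W$ to $U'\xrightarrow{\alpha'}V'\xrightarrow{\beta'}W'$ are triples $(f,g,h)$ of linear maps $f\colon U\to U'$, $g\colon V\to V'$, $h\colon W\to W'$ with $g\alpha=\alpha' f$ and $h\beta=\beta' g$. No condition is imposed on the composite $\beta\alpha$. A preabelian category is an additive category in which every morphism has a kernel and a cokernel. For a morphism $f$ in a preabelian category, let $\operatorname{coim} f$ be the cokernel of $\ker f$ and $\operatorname{im} f$ the kernel of $\operatorname{cok} f$; then $f=(\operatorname{im} f)\,\bar f\,\operatorname{coim} f$ for a unique $\bar f$. A preabelian category is left semi-abelian if $\bar f$ is a monomorphism for every morphism $f$. It is left integral if pullbacks of epimorphisms (along arbitrary morphisms) are epimorphisms, and right integral if pushouts of monomorphisms (along arbitrary morphisms) are monomorphisms. *)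

(* Defs.v *)
From HB Require Import structures.
From mathcomp Require Import all_boot all_algebra.
From mathcomp Require Import boolp.

Set Implicit Arguments.
Unset Strict Implicit.
Unset Printing Implicit Defensive.
Import GRing.Theory.
Local Open Scope ring_scope.
#[local] Obligation Tactic := idtac.

(* Categories enriched in abelian groups; [comp g f] is "g after f". *)
Record preadditive_category := PreadditiveCategory {
  obj :> Type;
  hom : obj -> obj -> zmodType;
  idm : forall A : obj, hom A A;
  comp : forall A B C : obj, hom B C -> hom A B -> hom A C;
  compA : forall (A B C D : obj) (h : hom C D) (g : hom B C) (f : hom A B),
    comp h (comp g f) = comp (comp h g) f;
  comp1m : forall (A B : obj) (f : hom A B), comp (idm B) f = f;
  compm1 : forall (A B : obj) (f : hom A B), comp f (idm A) = f;
  compDl : forall (A B C : obj) (g h : hom B C) (f : hom A B),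
    comp (g + h) f = comp g f + comp h f;
  compDr : forall (A B C : obj) (h : hom B C) (f g : hom A B),
    comp h (f + g) = comp h f + comp h g
}.

Arguments hom {p} A B.
Arguments idm {p} A.
Arguments comp {p A B C} g f.

Notation "g \oc f" := (comp g f) (at level 40, left associativity).

Definition monomorphism (C : preadditive_category) (A B : C) (f : hom A B) :=
  forall (T : C) (g h : hom T A), f \oc g = f \oc h -> g = h.

Definition epimorphism (C : preadditive_category) (A B : C) (f : hom A B) :=
  forall (T : C) (g h : hom B T), g \oc f = h \oc f -> g = h.

Definition is_zero_object (C : preadditive_category) (Z : C) :=
  (forall A : C, exists! f : hom A Z, True) /\
  (forall A : C, exists! f : hom Z A, True).

Definition is_biproduct (C : preadditive_category) (A B S : C)
    (iA : hom A S) (iB : hom B S) (pA : hom S A) (pB : hom S B) :=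
  [/\ pA \oc iA = idm A, pB \oc iB = idm B, pA \oc iB = 0, pB \oc iA = 0
    & iA \oc pA + iB \oc pB = idm S].

Definition additive_category (C : preadditive_category) :=
  (exists Z : C, is_zero_object Z) /\
  (forall A B : C, exists (S : C)
     (iA : hom A S) (iB : hom B S) (pA : hom S A) (pB : hom S B),
     is_biproduct iA iB pA pB).

Definition is_kernel (C : preadditive_category) (A B K : C)
    (f : hom A B) (k : hom K A) :=
  f \oc k = 0 /\
  forall (T : C) (t : hom T A), f \oc t = 0 -> exists! u : hom T K, k \oc u = t.

Definition is_cokernel (C : preadditive_category) (A B Q : C)
    (f : hom A B) (c : hom B Q) :=
  c \oc f = 0 /\
  forall (T : C) (t : hom B T), t \oc f = 0 -> exists! u : hom Q T, u \oc c = t.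

Definition preabelian (C : preadditive_category) :=
  additive_category C /\
  forall (A B : C) (f : hom A B),
    (exists (K : C) (k : hom K A), is_kernel f k) /\
    (exists (Q : C) (c : hom B Q), is_cokernel f c).

Definition is_pullback (C : preadditive_category) (A B X P : C)
    (f : hom A X) (g : hom B X) (p : hom P A) (q : hom P B) :=
  f \oc p = g \oc q /\
  forall (T : C) (s : hom T A) (t : hom T B), f \oc s = g \oc t ->
    exists! u : hom T P, p \oc u = s /\ q \oc u = t.

Definition is_pushout (C : preadditive_category) (X A B P : C)
    (f : hom X A) (g : hom X B) (i : hom A P) (j : hom B P) :=
  i \oc f = j \oc g /\
  forall (T : C) (s : hom A T) (t : hom B T), s \oc f = t \oc g ->
    exists! u : hom P T, u \oc i = s /\ u \oc j = t.

(* The next three properties are meant for preabelian categories.  There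
   kernels, cokernels, pullbacks and pushouts exist and are unique up to
   isomorphism, so quantifying over all of them is the same as choosing one. *)

(* [k = ker f], [c = cok f], [p = coim f = cok (ker f)],
   [i = im f = ker (cok f)], and [fbar] is the induced morphism. *)
Definition left_semi_abelian (C : preadditive_category) :=
  forall (A B K Q I J : C) (f : hom A B)
    (k : hom K A) (c : hom B Q) (p : hom A J) (i : hom I B) (fbar : hom J I),
    is_kernel f k -> is_cokernel f c -> is_cokernel k p -> is_kernel c i ->
    f = i \oc fbar \oc p -> monomorphism fbar.

Definition left_integral (C : preadditive_category) :=
  forall (A B X P : C) (f : hom A X) (g : hom B X) (p : hom P A) (q : hom P B),
    is_pullback f g p q -> epimorphism f -> epimorphism q.

Definition right_integral (C : preadditive_category) :=
  forall (X A B P : C) (f : hom X A) (g : hom X B) (i : hom A P) (j : hom B P),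
    is_pushout f g i j -> monomorphism f -> monomorphism j.

Definition full_subcategory (C : preadditive_category) (P : C -> Prop) :
  preadditive_category :=
  @PreadditiveCategory {A : C | P A}
    (fun A B => hom (sval A) (sval B))
    (fun A => idm (sval A))
    (fun A B D => @comp C (sval A) (sval B) (sval D))
    (fun A B D E => @compA C (sval A) (sval B) (sval D) (sval E))
    (fun A B => @comp1m C (sval A) (sval B))
    (fun A B => @compm1 C (sval A) (sval B))
    (fun A B D => @compDl C (sval A) (sval B) (sval D))
    (fun A B D => @compDr C (sval A) (sval B) (sval D)).

Record diagram (k : fieldType) := Diagram {
  dU : lmodType k;
  dV : lmodType k;
  dW : lmodType k;
  alpha : {linear dU -> dV};
  beta : {linear dV -> dW}
}.

Record diagram_hom (k : fieldType) (A B : diagram k) := DiagramHom {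
  homU : {linear dU A -> dU B};
  homV : {linear dV A -> dV B};
  homW : {linear dW A -> dW B};
  homV_alpha : forall u : dU A, homV (alpha A u) = alpha B (homU u);
  homW_beta : forall v : dV A, homW (beta A v) = beta B (homV v)
}.

Lemma linear_ext (k : fieldType) (U V : lmodType k) (f g : {linear U -> V}) :
  f =1 g -> f = g.
Proof.
case: f => f [[fD] [fZ]]; case: g => g [[gD] [gZ]] /= /funext fg.
case: g / fg gD gZ => gD gZ.
by rewrite (Prop_irrelevance fD gD) (Prop_irrelevance fZ gZ).
Qed.

Lemma diagram_hom_ext (k : fieldType) (A B : diagram k)
    (f g : diagram_hom A B) :
  homU f =1 homU g -> homV f =1 homV g -> homW f =1 homW g -> f = g.
Proof.
case: f => fU fV fW fa fb; case: g => gU gV gW ga gb /=.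
move=> /linear_ext eU /linear_ext eV /linear_ext eW.
move: ga gb; rewrite -{}eU -{}eV -{}eW => ga gb.
by rewrite (Prop_irrelevance fa ga) (Prop_irrelevance fb gb).
Qed.

(* Morphisms of diagrams form an abelian group under componentwise addition. *)
Program Definition diagram_hom_zero (k : fieldType) (A B : diagram k) :
  diagram_hom A B := @DiagramHom k A B \0 \0 \0 _ _.
Next Obligation. by move=> k A B u; rewrite /= linear0. Qed.
Next Obligation. by move=> k A B u; rewrite /= linear0. Qed.

Program Definition diagram_hom_opp (k : fieldType) (A B : diagram k)
    (f : diagram_hom A B) : diagram_hom A B :=
  @DiagramHom k A B (\- homU f) (\- homV f) (\- homW f) _ _.
Next Obligation. by move=> k A B f u; rewrite /= linearN homV_alpha. Qed.
Next Obligation. by move=> k A B f u; rewrite /= linearN homW_beta. Qed.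

Program Definition diagram_hom_add (k : fieldType) (A B : diagram k)
    (f g : diagram_hom A B) : diagram_hom A B :=
  @DiagramHom k A B (homU f \+ homU g) (homV f \+ homV g) (homW f \+ homW g)
    _ _.
Next Obligation. by move=> k A B f g u; rewrite /= linearD !homV_alpha. Qed.
Next Obligation. by move=> k A B f g u; rewrite /= linearD !homW_beta. Qed.

Lemma diagram_hom_addA (k : fieldType) (A B : diagram k) :
  associative (@diagram_hom_add k A B).
Proof. by move=> f g h; apply: diagram_hom_ext => x; rewrite /= addrA. Qed.

Lemma diagram_hom_addC (k : fieldType) (A B : diagram k) :
  commutative (@diagram_hom_add k A B).
Proof. by move=> f g; apply: diagram_hom_ext => x; rewrite /= addrC. Qed.

Lemma diagram_hom_add0 (k : fieldType) (A B : diagram k) :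
  left_id (diagram_hom_zero A B) (@diagram_hom_add k A B).
Proof. by move=> f; apply: diagram_hom_ext => x; rewrite /= add0r. Qed.

Lemma diagram_hom_addN (k : fieldType) (A B : diagram k) :
  left_inverse (diagram_hom_zero A B) (@diagram_hom_opp k A B)
    (@diagram_hom_add k A B).
Proof. by move=> f; apply: diagram_hom_ext => x; rewrite /= addNr. Qed.

HB.instance Definition _ (k : fieldType) (A B : diagram k) :=
  gen_eqMixin (diagram_hom A B).
HB.instance Definition _ (k : fieldType) (A B : diagram k) :=
  gen_choiceMixin (diagram_hom A B).
HB.instance Definition _ (k : fieldType) (A B : diagram k) :=
  GRing.isZmodule.Build (diagram_hom A B)
    (@diagram_hom_addA k A B) (@diagram_hom_addC k A B)
    (@diagram_hom_add0 k A B) (@diagram_hom_addN k A B).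

Definition diagram_idm (k : fieldType) (A : diagram k) : diagram_hom A A :=
  @DiagramHom k A A idfun idfun idfun (fun=> erefl) (fun=> erefl).

Program Definition diagram_comp (k : fieldType) (A B C : diagram k)
    (g : diagram_hom B C) (f : diagram_hom A B) : diagram_hom A C :=
  @DiagramHom k A C
    (homU g \o homU f) (homV g \o homV f) (homW g \o homW f) _ _.
Next Obligation. by move=> k A B C g f u; rewrite /= !homV_alpha. Qed.
Next Obligation. by move=> k A B C g f u; rewrite /= !homW_beta. Qed.

Program Definition diagram_category (k : fieldType) : preadditive_category :=
  @PreadditiveCategory (diagram k) (fun A B => diagram_hom A B : zmodType)
    (@diagram_idm k) (@diagram_comp k) _ _ _ _ _.
Next Obligation. by move=> *; apply: diagram_hom_ext. Qed.
Next Obligation. by move=> *; apply: diagram_hom_ext. Qed.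
Next Obligation. by move=> *; apply: diagram_hom_ext. Qed.
Next Obligation. by move=> *; apply: diagram_hom_ext. Qed.
Next Obligation.
by move=> k A B C h f g; apply: diagram_hom_ext => x; rewrite /= linearD.
Qed.

(* [V = im alpha + ker beta]. *)
Definition im_plus_ker (k : fieldType) (A : diagram k) : Prop :=
  forall v : dV A, exists (u : dU A) (x : dV A),
    beta A x = 0 /\ v = alpha A u + x.

Definition im_plus_ker_category (k : fieldType) : preadditive_category :=
  @full_subcategory (diagram_category k) (@im_plus_ker k).

(* Main.v *)
From HB Require Import structures.
From mathcomp Require Import all_boot all_algebra.
From mathcomp Require Import boolp.
Require Import Defs.

Set Implicit Arguments.
Unset Strict Implicit.
Unset Printing Implicit Defensive.
Import GRing.Theory.
Local Open Scope ring_scope.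
Local Open Scope quotient_scope.

(** The condition V = im alpha + ker beta passes to direct sums and to
quotient diagrams, but not to subdiagrams. Direct sums and cokernels are
therefore computed componentwise in the subcategory. A kernel is obtained from
the componentwise kernel (ker f, ker g, ker h) of a morphism (f, g, h) by
shrinking its middle space to the largest one satisfying the condition, namely
to the sum of alpha (ker f) and the part of ker g annihilated by beta
([has_kernel], [has_cokernel]).

Nevertheless the monomorphisms are exactly the componentwise injective
morphisms: if the shrunken kernel vanishes, then ker h = 0, so beta annihilates
ker g, and the middle space of the kernel was not shrunk at all
([mono_injective]). Pushouts are componentwise, being cokernels of maps into
direct sums, and pushouts of injective linear maps are injective. This gives
right integrality.

The two failures come from one diagram, k = k = k, the one-dimensional spaces
with identity maps. Killing its last space gives an epimorphism onto
k = k -> 0. The projection of k = k = k onto k -> 0 -> 0 has the componentwise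
kernel 0 -> k = k, whose middle space must be dropped: its kernel is
0 -> 0 -> k. So the coimage of k = k = k onto k -> 0 -> 0 is k = k -> 0, and its
map to the image k -> 0 -> 0 kills the subdiagram 0 -> k -> 0
([im_plus_ker_not_left_semi_abelian]). For the same reason the pullback of the
epimorphism from k = k = k to k = k -> 0 along the inclusion of 0 -> k -> 0 is
0 -> 0 -> k, whose projection to 0 -> k -> 0 is zero
([im_plus_ker_not_left_integral]). *)

(** * Subspaces, kernels and cokernels of linear maps *)

Section Subspace.
Context (k : fieldType) (V : lmodType k) (S : submodClosed V).

Record subspace := Subspace { subspace_val : V; _ : subspace_val \in S }.

HB.instance Definition _ := [isSub for subspace_val].
HB.instance Definition _ := [Choice of subspace by <:].
HB.instance Definition _ := [SubChoice_isSubLmodule of subspace by <:].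

Definition subspace_incl : {linear subspace -> V} := val.

Lemma subspace_inclP (x : subspace) : subspace_incl x \in S.
Proof. exact: valP. Qed.

Lemma subspace_incl_inj : injective subspace_incl.
Proof. exact: val_inj. Qed.

Context (T : lmodType k) (f : {linear T -> V}) (fS : forall t, f t \in S).

Definition subspace_lift_fun (t : T) : subspace := Subspace (fS t).

Lemma subspace_lift_is_linear : linear subspace_lift_fun.
Proof. by move=> a x y; apply: val_inj; rewrite /= linearP. Qed.

HB.instance Definition _ := GRing.isLinear.Build k T subspace _
  subspace_lift_fun subspace_lift_is_linear.

Definition subspace_lift : {linear T -> subspace} := subspace_lift_fun.

End Subspace.

Arguments subspace_incl {k V S}.

Section Cokernel.
Context (k : fieldType) (U V : lmodType k) (f : {linear U -> V}).

Definition range_pred (v : V) : bool := `[< exists u, f u = v >].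

Lemma range_predP v : reflect (exists u, f u = v) (v \in range_pred).
Proof. exact: asboolP. Qed.

Lemma range_submod : GRing.subsemimod_closed range_pred.
Proof.
split.
  split; first by apply/range_predP; exists 0; rewrite linear0.
  move=> _ _ /range_predP[x <-] /range_predP[y <-].
  by apply/range_predP; exists (x + y); rewrite linearD.
move=> a _ /range_predP[x <-].
by apply/range_predP; exists (a *: x); rewrite linearZ.
Qed.

HB.instance Definition _ :=
  GRing.isSubmodClosed.Build k V range_pred range_submod.

Definition coker := Quotient.quot (GRing.ZmodClosed.clone V range_pred _).
HB.instance Definition _ := GRing.Zmodule.on coker.

Definition coker_pi (v : V) : coker := \pi_(coker) v.

Lemma coker_pi_eq x y : coker_pi x = coker_pi y <-> exists u, f u = x - y.
Proof.
split=> [/eqP|xy].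
  by rewrite /coker_pi -Quotient.idealrBE => /range_predP.
by apply/eqP; rewrite /coker_pi -Quotient.idealrBE; apply/range_predP.
Qed.

Lemma coker_pi_repr (q : coker) : coker_pi (repr q) = q.
Proof. exact: reprK. Qed.

Lemma coker_piD : {morph coker_pi : x y / x + y}.
Proof. by move=> x y; rewrite /coker_pi !piE. Qed.

(** Scaling a chosen representative is independent of the choice because the
range of f is stable under scaling ([coker_scale_pi]). *)
Definition coker_scale (a : k) (q : coker) : coker := coker_pi (a *: repr q).

Lemma coker_scale_pi a v : coker_scale a (coker_pi v) = coker_pi (a *: v).
Proof.
apply/coker_pi_eq; have /coker_pi_eq[u e] := coker_pi_repr (coker_pi v).
by exists (a *: u); rewrite linearZ /= e scalerBr.
Qed.

Lemma coker_scaleA a b q :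
  coker_scale a (coker_scale b q) = coker_scale (a * b) q.
Proof. by rewrite -(coker_pi_repr q) !coker_scale_pi scalerA. Qed.

Lemma coker_scale1 : left_id 1 coker_scale.
Proof. by move=> q; rewrite -(coker_pi_repr q) coker_scale_pi scale1r. Qed.

Lemma coker_scaleDr : right_distributive coker_scale +%R.
Proof.
move=> a p q; rewrite -(coker_pi_repr p) -(coker_pi_repr q).
by rewrite -coker_piD !coker_scale_pi scalerDr coker_piD.
Qed.

Lemma coker_scaleDl q : {morph coker_scale^~ q : a b / a + b}.
Proof.
by move=> a b; rewrite -(coker_pi_repr q) !coker_scale_pi scalerDl coker_piD.
Qed.

HB.instance Definition _ := GRing.Zmodule_isLmodule.Build k coker
  coker_scaleA coker_scale1 coker_scaleDr coker_scaleDl.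

Lemma coker_pi_is_linear : linear coker_pi.
Proof. by move=> a x y; rewrite coker_piD -coker_scale_pi. Qed.

HB.instance Definition _ := GRing.isLinear.Build k V coker _
  coker_pi coker_pi_is_linear.

Definition coker_proj : {linear V -> coker} := coker_pi.

Lemma coker_proj_eq0 v : coker_proj v = 0 <-> exists u, f u = v.
Proof. by rewrite -[0](linear0 coker_proj) coker_pi_eq subr0. Qed.

Lemma coker_projK u : coker_proj (f u) = 0.
Proof. by apply/coker_proj_eq0; exists u. Qed.

Lemma coker_proj_surj q : exists v, coker_proj v = q.
Proof. by exists (repr q); apply: coker_pi_repr. Qed.

Context (T : lmodType k) (t : {linear V -> T}) (tf : forall u, t (f u) = 0).

Definition coker_desc_fun (q : coker) : T := t (repr q).

Lemma coker_desc_pi v : coker_desc_fun (coker_pi v) = t v.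
Proof.
have /coker_pi_eq[u e] := coker_pi_repr (coker_pi v).
by apply/eqP; rewrite -subr_eq0 -linearB -e tf.
Qed.

Lemma coker_desc_is_linear : linear coker_desc_fun.
Proof.
move=> a p q; have [x <-] := coker_proj_surj p; have [y <-] := coker_proj_surj q.
by rewrite -linearP !coker_desc_pi linearP.
Qed.

HB.instance Definition _ := GRing.isLinear.Build k coker T _
  coker_desc_fun coker_desc_is_linear.

Definition coker_desc : {linear coker -> T} := coker_desc_fun.

Lemma coker_desc_proj v : coker_desc (coker_proj v) = t v.
Proof. exact: coker_desc_pi. Qed.

End Cokernel.

Section LinearKernel.
Context (k : fieldType) (U V : lmodType k) (f : {linear U -> V}).

Definition ker_pred (u : U) : bool := f u == 0.

Lemma ker_predP u : reflect (f u = 0) (u \in ker_pred).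
Proof. exact: eqP. Qed.

Lemma ker_submod : GRing.subsemimod_closed ker_pred.
Proof.
split; first split.
- by apply/ker_predP; rewrite linear0.
- move=> x y /ker_predP x0 /ker_predP y0.
  by apply/ker_predP; rewrite linearD x0 y0 addr0.
- by move=> a x /ker_predP x0; apply/ker_predP; rewrite linearZ /= x0 scaler0.
Qed.

HB.instance Definition _ := GRing.isSubmodClosed.Build k U ker_pred ker_submod.

End LinearKernel.

(** * Kernels and cokernels of diagrams *)

Section DiagramConstructions.
Context (k : fieldType).
Local Notation D := (im_plus_ker_category k).

Lemma im_plus_ker_quotient (A B : diagram k) (f : diagram_hom A B) :
  (forall w, exists v, homV f v = w) -> im_plus_ker A -> im_plus_ker B.
Proof.
move=> fV DA w; have [v <-] := fV w; have [u [x [bx ->]]] := DA v.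
exists (homU f u), (homV f x).
by rewrite -homW_beta bx linear0 linearD homV_alpha.
Qed.

(** For T in the subcategory, the image of beta T is that of beta T o alpha T, so
a morphism out of T that vanishes on the first space has a middle component
annihilated by beta A. This is what makes middle spaces shrink in kernels and
pullbacks. *)
Lemma im_plus_ker_beta (T A : diagram k) (t : diagram_hom T A) :
  im_plus_ker T -> (forall u, homU t u = 0) -> forall v, beta A (homV t v) = 0.
Proof.
move=> DT tU v; have [u [x [bx ->]]] := DT v.
by rewrite linearD homV_alpha tU linear0 add0r -homW_beta bx linear0.
Qed.

Section Kernel.
Context (A B : diagram k) (f : diagram_hom A B).

(** The largest middle space over the kernels of [homU f] and [homW f] that lies
in the kernel of [homV f] and makes the diagram satisfy V = im alpha + ker
beta. *)
Definition kerV_pred (v : dV A) : bool :=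
  (homV f v == 0) &&
  `[< exists u x, [/\ homU f u = 0, beta A x = 0 & v = alpha A u + x] >].

Lemma kerV_predP v :
  reflect (homV f v = 0 /\ exists u x,
             [/\ homU f u = 0, beta A x = 0 & v = alpha A u + x])
          (v \in kerV_pred).
Proof.
by apply: (iffP andP) => -[/eqP fv /asboolP e]; split=> //; apply/asboolP.
Qed.

Lemma kerV_submod : GRing.subsemimod_closed kerV_pred.
Proof.
split; first split.
- apply/kerV_predP; split; first exact: linear0.
  by exists 0, 0; rewrite !linear0 addr0.
- move=> v w /kerV_predP[v0 [u [x [u0 x0 ev]]]].
  move=> /kerV_predP[w0 [u' [x' [u'0 x'0 ew]]]].
  apply/kerV_predP; split; first by rewrite linearD v0 w0 addr0.
  exists (u + u'), (x + x').
  by rewrite !linearD u0 u'0 x0 x'0 !addr0 ev ew addrACA.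
- move=> a v /kerV_predP[v0 [u [x [u0 x0 ev]]]].
  apply/kerV_predP; split; first by rewrite linearZ /= v0 scaler0.
  exists (a *: u), (a *: x).
  by rewrite !linearZ /= u0 x0 !scaler0 ev scalerDr.
Qed.

HB.instance Definition _ := GRing.isSubmodClosed.Build k _ kerV_pred kerV_submod.

Definition kerU : lmodType k :=
  subspace (GRing.SubmodClosed.clone k _ (ker_pred (homU f)) _).
Definition kerV : lmodType k :=
  subspace (GRing.SubmodClosed.clone k _ kerV_pred _).
Definition kerW : lmodType k :=
  subspace (GRing.SubmodClosed.clone k _ (ker_pred (homW f)) _).

Lemma ker_alpha_subproof (u : kerU) :
  (alpha A \o subspace_incl) u \in kerV_pred.
Proof.
have /ker_predP u0 := subspace_inclP u; apply/kerV_predP => /=; split.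
  by rewrite homV_alpha u0 linear0.
by exists (subspace_incl u), 0; rewrite linear0 addr0.
Qed.

Lemma ker_beta_subproof (v : kerV) :
  (beta A \o subspace_incl) v \in ker_pred (homW f).
Proof.
have /kerV_predP[v0 _] := subspace_inclP v.
by apply/ker_predP; rewrite /= homW_beta v0 linear0.
Qed.

Definition ker_diagram : diagram k := @Diagram k kerU kerV kerW
  (subspace_lift ker_alpha_subproof) (subspace_lift ker_beta_subproof).

Definition ker_incl : diagram_hom ker_diagram A :=
  @DiagramHom k ker_diagram A
    (subspace_incl) (subspace_incl) (subspace_incl)
    (fun=> erefl) (fun=> erefl).

(** In a decomposition v = alpha u + x of an element of the kernel with u in the
kernel, x lies in the kernel too, so the decomposition stays inside. *)
Lemma ker_im_plus_ker : im_plus_ker ker_diagram.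
Proof.
move=> v; have /kerV_predP[v0 [u [x [u0 x0 ev]]]] := subspace_inclP v.
have Uu : u \in ker_pred (homU f) by apply/ker_predP.
have Vx : x \in kerV_pred.
  apply/kerV_predP; split; last by exists 0, x; rewrite !linear0 add0r.
  by apply/eqP; move/eqP: v0; rewrite ev linearD homV_alpha u0 linear0 add0r.
exists (Subspace Uu), (Subspace Vx); split; first exact: subspace_incl_inj.
exact: subspace_incl_inj.
Qed.

Lemma ker_incl_comp : diagram_comp f ker_incl = 0.
Proof.
apply: diagram_hom_ext => x /=.
- by have /ker_predP-> := subspace_inclP x.
- by have /kerV_predP[-> _] := subspace_inclP x.
- by have /ker_predP-> := subspace_inclP x.
Qed.

Context (T : diagram k) (t : diagram_hom T A) (DT : im_plus_ker T).
Hypothesis ft : diagram_comp f t = 0.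

Lemma ker_liftU_subproof u : homU t u \in ker_pred (homU f).
Proof. by apply/ker_predP; rewrite -[LHS]/(homU (diagram_comp f t) u) ft. Qed.

Lemma ker_liftW_subproof w : homW t w \in ker_pred (homW f).
Proof. by apply/ker_predP; rewrite -[LHS]/(homW (diagram_comp f t) w) ft. Qed.

(** The decomposition of v in T is carried by t to one whose first part comes from
the kernel of [homU f]; this is where T must be in the subcategory. *)
Lemma ker_liftV_subproof v : homV t v \in kerV_pred.
Proof.
apply/kerV_predP; split.
  by rewrite -[LHS]/(homV (diagram_comp f t) v) ft.
have [u [x [x0 ->]]] := DT v; exists (homU t u), (homV t x); split.
- by apply/ker_predP; apply: ker_liftU_subproof.
- by rewrite -homW_beta x0 linear0.
- by rewrite linearD homV_alpha.
Qed.

Lemma ker_lift_alpha u :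
  subspace_lift ker_liftV_subproof (alpha T u) =
  alpha ker_diagram (subspace_lift ker_liftU_subproof u).
Proof. by apply: subspace_incl_inj; rewrite /= homV_alpha. Qed.

Lemma ker_lift_beta v :
  subspace_lift ker_liftW_subproof (beta T v) =
  beta ker_diagram (subspace_lift ker_liftV_subproof v).
Proof. by apply: subspace_incl_inj; rewrite /= homW_beta. Qed.

Definition ker_lift : diagram_hom T ker_diagram :=
  @DiagramHom k T ker_diagram (subspace_lift ker_liftU_subproof)
    (subspace_lift ker_liftV_subproof) (subspace_lift ker_liftW_subproof)
    ker_lift_alpha ker_lift_beta.

Lemma ker_incl_lift : diagram_comp ker_incl ker_lift = t.
Proof. exact: diagram_hom_ext. Qed.

End Kernel.

Lemma ker_incl_mono (A B T : diagram k) (f : diagram_hom A B)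
    (t t' : diagram_hom T (ker_diagram f)) :
  diagram_comp (ker_incl f) t = diagram_comp (ker_incl f) t' -> t = t'.
Proof.
move=> e; apply: diagram_hom_ext => x; apply: subspace_incl_inj.
- exact: (congr1 (fun h => homU h x) e).
- exact: (congr1 (fun h => homV h x) e).
- exact: (congr1 (fun h => homW h x) e).
Qed.

Lemma has_kernel (A B : D) (f : hom A B) :
  exists (K : D) (i : hom K A), is_kernel f i.
Proof.
case: A B f => [A DA] [B DB] f.
exists (exist _ _ (@ker_im_plus_ker A B f)), (ker_incl f).
split=> [|[T DT] t ft]; first exact: ker_incl_comp.
exists (ker_lift DT ft); split=> [|s es]; first exact: ker_incl_lift.
by apply: ker_incl_mono; rewrite [RHS]es; apply: ker_incl_lift.
Qed.

Section Cokernel.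
Context (A B : diagram k) (f : diagram_hom A B).

Lemma coker_alpha_subproof u :
  (coker_proj (homV f) \o alpha B) (homU f u) = 0.
Proof. by rewrite /= -homV_alpha coker_projK. Qed.

Lemma coker_beta_subproof v :
  (coker_proj (homW f) \o beta B) (homV f v) = 0.
Proof. by rewrite /= -homW_beta coker_projK. Qed.

Definition coker_diagram : diagram k :=
  Diagram (coker_desc coker_alpha_subproof) (coker_desc coker_beta_subproof).

Lemma coker_quo_alpha u :
  coker_proj (homV f) (alpha B u) =
  alpha coker_diagram (coker_proj (homU f) u).
Proof. by rewrite coker_desc_proj. Qed.

Lemma coker_quo_beta v :
  coker_proj (homW f) (beta B v) =
  beta coker_diagram (coker_proj (homV f) v).
Proof. by rewrite coker_desc_proj. Qed.

Definition coker_quo : diagram_hom B coker_diagram :=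
  @DiagramHom k B coker_diagram (coker_proj (homU f)) (coker_proj (homV f))
    (coker_proj (homW f)) coker_quo_alpha coker_quo_beta.

Lemma coker_im_plus_ker : im_plus_ker B -> im_plus_ker coker_diagram.
Proof. apply: (im_plus_ker_quotient (f := coker_quo)); exact: coker_proj_surj. Qed.

Lemma coker_quo_comp : diagram_comp coker_quo f = 0.
Proof. by apply: diagram_hom_ext => x; exact: coker_projK. Qed.

Lemma coker_quo_epi (T : diagram k) (t t' : diagram_hom coker_diagram T) :
  diagram_comp t coker_quo = diagram_comp t' coker_quo -> t = t'.
Proof.
move=> e; apply: diagram_hom_ext => y; have [x <-] := coker_proj_surj y.
- exact: (congr1 (fun h => homU h x) e).
- exact: (congr1 (fun h => homV h x) e).
- exact: (congr1 (fun h => homW h x) e).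
Qed.

Context (T : diagram k) (t : diagram_hom B T).
Hypothesis tf : diagram_comp t f = 0.

Lemma coker_descU_subproof u : homU t (homU f u) = 0.
Proof. by rewrite -[LHS]/(homU (diagram_comp t f) u) tf. Qed.

Lemma coker_descV_subproof v : homV t (homV f v) = 0.
Proof. by rewrite -[LHS]/(homV (diagram_comp t f) v) tf. Qed.

Lemma coker_descW_subproof w : homW t (homW f w) = 0.
Proof. by rewrite -[LHS]/(homW (diagram_comp t f) w) tf. Qed.

Lemma coker_fact_alpha u :
  coker_desc coker_descV_subproof (alpha coker_diagram u) =
  alpha T (coker_desc coker_descU_subproof u).
Proof.
have [x <-] := coker_proj_surj u.
by rewrite [alpha _ _]coker_desc_proj !coker_desc_proj homV_alpha.
Qed.

Lemma coker_fact_beta v :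
  coker_desc coker_descW_subproof (beta coker_diagram v) =
  beta T (coker_desc coker_descV_subproof v).
Proof.
have [x <-] := coker_proj_surj v.
by rewrite [beta _ _]coker_desc_proj !coker_desc_proj homW_beta.
Qed.

Definition coker_fact : diagram_hom coker_diagram T :=
  @DiagramHom k coker_diagram T (coker_desc coker_descU_subproof)
    (coker_desc coker_descV_subproof) (coker_desc coker_descW_subproof)
    coker_fact_alpha coker_fact_beta.

Lemma coker_fact_quo : diagram_comp coker_fact coker_quo = t.
Proof.
apply: diagram_hom_ext => x.
- exact: (coker_desc_proj coker_descU_subproof x).
- exact: (coker_desc_proj coker_descV_subproof x).
- exact: (coker_desc_proj coker_descW_subproof x).
Qed.

End Cokernel.

Lemma has_cokernel (A B : D) (f : hom A B) :
  exists (Q : D) (c : hom B Q), is_cokernel f c.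
Proof.
case: A B f => [A DA] [B DB] f.
exists (exist _ _ (@coker_im_plus_ker A B f DB)), (coker_quo f).
split=> [|[T DT] t tf]; first exact: coker_quo_comp.
exists (coker_fact tf); split=> [|s es]; first exact: coker_fact_quo.
by apply: coker_quo_epi; rewrite [RHS]es; apply: coker_fact_quo.
Qed.

End DiagramConstructions.

(** * Zero object and biproducts *)

Section Additive.
Context (k : fieldType).
Local Notation D := (im_plus_ker_category k).

Definition null_space : lmodType k := 'rV[k]_0.

Lemma null_space_eq (x y : null_space) : x = y.
Proof. by rewrite (thinmx0 x) (thinmx0 y). Qed.

Definition zero_diagram : diagram k :=
  @Diagram k null_space null_space null_space \0 \0.

Lemma zero_im_plus_ker : im_plus_ker zero_diagram.
Proof. by move=> v; exists 0, v; split=> //; apply: null_space_eq. Qed.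

Lemma has_zero_object : exists Z : D, is_zero_object Z.
Proof.
exists (exist _ _ zero_im_plus_ker); split=> -[A DA]; exists 0; split=> // f _.
  by apply: diagram_hom_ext => x; apply: null_space_eq.
by apply: diagram_hom_ext => x; rewrite (null_space_eq x 0) !linear0.
Qed.

Section PairLinear.
Context (T V W : lmodType k) (f : {linear T -> V}) (g : {linear T -> W}).

Definition pair_fun (t : T) : (V * W)%type := (f t, g t).

Lemma pair_is_linear : linear pair_fun.
Proof. by move=> a x y; rewrite /pair_fun !linearP. Qed.

HB.instance Definition _ := GRing.isLinear.Build k T _ _ pair_fun pair_is_linear.

Definition pair_linear : {linear T -> (V * W)%type} := pair_fun.

End PairLinear.

Lemma pair_decomposition (V W : lmodType k) (x : V * W) :
  (x.1, 0) + (0, x.2) = x.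
Proof. by case: x => x y; rewrite -[LHS]/(x + 0, 0 + y) addr0 add0r. Qed.

Section Biproduct.
Context (A B : diagram k).

Definition sum_diagram : diagram k :=
  @Diagram k (dU A * dU B)%type (dV A * dV B)%type (dW A * dW B)%type
    (pair_linear (alpha A \o fst) (alpha B \o snd))
    (pair_linear (beta A \o fst) (beta B \o snd)).

Lemma sum_im_plus_ker :
  im_plus_ker A -> im_plus_ker B -> im_plus_ker sum_diagram.
Proof.
move=> DA DB [v w]; have [u [x [x0 ->]]] := DA v.
have [u' [x' [x'0 ->]]] := DB w.
by exists (u, u'), (x, x'); rewrite /= /pair_fun /= x0 x'0.
Qed.

Definition inl_linear (V W : lmodType k) : {linear V -> (V * W)%type} :=
  pair_linear idfun \0.
Definition inr_linear (V W : lmodType k) : {linear W -> (V * W)%type} :=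
  pair_linear \0 idfun.

Lemma inl_alpha u :
  inl_linear _ _ (alpha A u) = alpha sum_diagram (inl_linear _ _ u).
Proof. by rewrite /= /pair_fun /= linear0. Qed.

Lemma inl_beta v :
  inl_linear _ _ (beta A v) = beta sum_diagram (inl_linear _ _ v).
Proof. by rewrite /= /pair_fun /= linear0. Qed.

Lemma inr_alpha u :
  inr_linear _ _ (alpha B u) = alpha sum_diagram (inr_linear _ _ u).
Proof. by rewrite /= /pair_fun /= linear0. Qed.

Lemma inr_beta v :
  inr_linear _ _ (beta B v) = beta sum_diagram (inr_linear _ _ v).
Proof. by rewrite /= /pair_fun /= linear0. Qed.

Definition sum_inl : diagram_hom A sum_diagram :=
  @DiagramHom k A sum_diagram (inl_linear _ _) (inl_linear _ _)
    (inl_linear _ _) inl_alpha inl_beta.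

Definition sum_inr : diagram_hom B sum_diagram :=
  @DiagramHom k B sum_diagram (inr_linear _ _) (inr_linear _ _)
    (inr_linear _ _) inr_alpha inr_beta.

Definition sum_fst : diagram_hom sum_diagram A :=
  @DiagramHom k sum_diagram A fst fst fst (fun=> erefl) (fun=> erefl).

Definition sum_snd : diagram_hom sum_diagram B :=
  @DiagramHom k sum_diagram B snd snd snd (fun=> erefl) (fun=> erefl).

End Biproduct.

Lemma has_biproduct (A B : D) : exists (S : D)
  (iA : hom A S) (iB : hom B S) (pA : hom S A) (pB : hom S B),
  is_biproduct iA iB pA pB.
Proof.
case: A B => [A DA] [B DB].
exists (exist _ _ (sum_im_plus_ker DA DB)), (sum_inl A B), (sum_inr A B).
exists (sum_fst A B), (sum_snd A B).
split; apply: diagram_hom_ext => x //; exact: pair_decomposition.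
Qed.

Lemma im_plus_ker_preabelian : preabelian D.
Proof.
split; first by split; [exact: has_zero_object | exact: has_biproduct].
by move=> A B f; split; [exact: has_kernel | exact: has_cokernel].
Qed.

End Additive.

(** * Monomorphisms and their pushouts *)

Section RightIntegral.
Context (k : fieldType).
Local Notation D := (im_plus_ker_category k).

Definition componentwise_injective (A B : diagram k) (f : diagram_hom A B) :=
  [/\ injective (homU f), injective (homV f) & injective (homW f)].

Lemma linear_inj0 (V W : lmodType k) (f : {linear V -> W}) :
  (forall v, f v = 0 -> v = 0) -> injective f.
Proof.
by move=> f0 x y e; apply/eqP; rewrite -subr_eq0 (f0 (x - y)) // linearB e subrr.
Qed.

Lemma injective_mono (A B : D) (f : hom A B) :
  componentwise_injective f -> monomorphism f.
Proof.
move=> [fU fV fW] T g h e; apply: diagram_hom_ext => x.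
- by apply: fU; exact: (congr1 (fun h => homU h x) e).
- by apply: fV; exact: (congr1 (fun h => homV h x) e).
- by apply: fW; exact: (congr1 (fun h => homW h x) e).
Qed.

(** The inclusion of the kernel composes with f to 0, so it is 0 when f is a
monomorphism. This gives injectivity on the outer spaces at once. If
[homV f v = 0] then [beta A v] is in the kernel of the injective [homW f], hence
0, so v does belong to the middle space of the kernel. *)
Lemma mono_injective (A B : D) (f : hom A B) :
  monomorphism f -> componentwise_injective f.
Proof.
case: A B f => [A DA] [B DB] f mf.
have k0 : ker_incl f = 0.
  apply: (mf (exist _ _ (@ker_im_plus_ker k A B f))).
  rewrite [LHS]ker_incl_comp; by apply: diagram_hom_ext => x /=; rewrite linear0.
have U0 u : homU f u = 0 -> u = 0.
  move=> /ker_predP fu.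
  exact: (congr1 (fun h : diagram_hom (ker_diagram f) A => homU h (Subspace fu)) k0).
have W0 w : homW f w = 0 -> w = 0.
  move=> /ker_predP fw.
  exact: (congr1 (fun h : diagram_hom (ker_diagram f) A => homW h (Subspace fw)) k0).
have V0 v : homV f v = 0 -> v = 0.
  move=> fv; have bv : beta A v = 0 by apply: W0; rewrite homW_beta fv linear0.
  have Kv : v \in kerV_pred f.
    by apply/kerV_predP; split=> //; exists 0, v; rewrite !linear0 add0r.
  exact: (congr1 (fun h : diagram_hom (ker_diagram f) A => homV h (Subspace Kv)) k0).
by split; apply: linear_inj0.
Qed.

(** The cokernel of (f, -g) : X -> V * W is the pushout of f and g, and the map
from W into it is injective when f is: (0, w) = (f x, - g x) forces x = 0. *)
Lemma coker_pushout_injective (X V W : lmodType k) (f : {linear X -> V})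
    (h : {linear X -> (V * W)%type}) :
  injective f -> (forall x, (h x).1 = f x) ->
  injective (coker_proj h \o inr_linear V W).
Proof.
move=> fI hf; apply: linear_inj0 => w /coker_proj_eq0[x hx].
have x0 : x = 0 by apply: fI; rewrite -hf hx linear0.
by move: hx; rewrite x0 linear0 => /(congr1 snd).
Qed.

(** The pushout is only known through its universal property, and it suffices to
produce a commutative square under f and g whose second leg t is a
monomorphism: t factors through j, so j is a monomorphism as well. That square
is the explicit pushout, the cokernel of f - g into the direct sum. *)
Lemma im_plus_ker_right_integral : right_integral D.
Proof.
move=> [X DX] [A DA] [B DB] [P DP] f g i j [_ univ] /mono_injective[fU fV fW].
pose h := diagram_comp (sum_inl A B) f - diagram_comp (sum_inr A B) g.
pose Q : D := exist _ _ (@coker_im_plus_ker k X _ h (sum_im_plus_ker DA DB)).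
pose c : diagram_hom (sum_diagram A B) (sval Q) := coker_quo h.
pose s : hom (exist _ A DA : D) Q := diagram_comp c (sum_inl A B).
pose t : hom (exist _ B DB : D) Q := diagram_comp c (sum_inr A B).
have st : s \oc f = t \oc g.
  apply/eqP; rewrite -subr_eq0; apply/eqP.
  rewrite -[RHS](coker_quo_comp h); apply: diagram_hom_ext => x /=.
  - by rewrite linearB.
  - by rewrite linearB.
  - by rewrite linearB.
have mt : monomorphism t.
  apply: injective_mono; split.
  - apply: (coker_pushout_injective fU) => x; exact: subr0.
  - apply: (coker_pushout_injective fV) => x; exact: subr0.
  - apply: (coker_pushout_injective fW) => x; exact: subr0.
have [u [[_ uj] _]] := univ Q s t st.
by move=> T a b e; apply: mt; rewrite -uj -!compA e.
Qed.

End RightIntegral.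

(** * Failure of the left-hand properties *)

Section Counterexample.
Context (k : fieldType).
Local Notation D := (im_plus_ker_category k).
Local Notation line := (k^o : lmodType k).
Local Notation null := (null_space k).

Lemma from_null (V : lmodType k) (f : {linear null -> V}) x : f x = 0.
Proof. by rewrite (null_space_eq x 0) linear0. Qed.

(** The digits are the dimensions of the three spaces; neighbouring lines are
joined by the identity. *)
Definition d111 : diagram k := @Diagram k line line line idfun idfun.
Definition d110 : diagram k := @Diagram k line line null idfun \0.
Definition d100 : diagram k := @Diagram k line null null \0 \0.
Definition d010 : diagram k := @Diagram k null line null \0 \0.
Definition d001 : diagram k := @Diagram k null null line \0 \0.

Lemma alpha_surj_im_plus_ker (A : diagram k) :
  (forall v, exists u, alpha A u = v) -> im_plus_ker A.
Proof.
move=> aA v; have [u <-] := aA v.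
by exists u, 0; rewrite linear0 addr0.
Qed.

Lemma beta0_im_plus_ker (A : diagram k) :
  (forall v, beta A v = 0) -> im_plus_ker A.
Proof. by move=> b0 v; exists 0, v; rewrite linear0 add0r. Qed.

Definition D111 : D := exist _ d111
  (alpha_surj_im_plus_ker (A := d111) (fun v => ex_intro _ v erefl)).
Definition D110 : D := exist _ d110
  (alpha_surj_im_plus_ker (A := d110) (fun v => ex_intro _ v erefl)).
Definition D100 : D := exist _ d100
  (beta0_im_plus_ker (A := d100) (fun=> erefl)).
Definition D010 : D := exist _ d010
  (beta0_im_plus_ker (A := d010) (fun=> erefl)).
Definition D001 : D := exist _ d001
  (beta0_im_plus_ker (A := d001) (fun=> erefl)).

Definition incl001 : hom D001 D111 :=
  @DiagramHom k d001 d111 \0 \0 idfun (fun=> erefl) (fun=> erefl).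
Definition quo110 : hom D111 D110 :=
  @DiagramHom k d111 d110 idfun idfun \0 (fun=> erefl) (fun=> erefl).
Definition quo100 : hom D110 D100 :=
  @DiagramHom k d110 d100 idfun \0 \0 (fun=> erefl) (fun=> erefl).
Definition incl010 : hom D010 D110 :=
  @DiagramHom k d010 d110 \0 idfun \0 (fun=> erefl) (fun=> erefl).

(** With identity maps in the target, beta (t v) = 0 says t v = 0: a morphism to
[D111] that vanishes on the first space vanishes on the second. Both
universal properties of [D001], as a kernel and as a pullback, follow. *)
Lemma factor_through_incl001 (T : D) (t : hom T D111) :
  (forall u, homU t u = 0) ->
  (forall v, homV t v = 0) /\ exists! s : hom T D001, incl001 \oc s = t.
Proof.
case: T t => [T DT] t tU; have tV v : homV t v = 0.
  exact: (im_plus_ker_beta DT tU v).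
split=> //.
have sa (u : dU T) :
  (\0 : {linear dV T -> null}) (alpha T u) =
  alpha d001 ((\0 : {linear dU T -> null}) u) by [].
have sb (v : dV T) :
    homW t (beta T v) = beta d001 ((\0 : {linear dV T -> null}) v).
  by rewrite homW_beta tV.
exists (@DiagramHom k T d001 \0 \0 (homW t) sa sb); split.
  by apply: diagram_hom_ext => x //=; rewrite ?tU ?tV.
move=> s es; apply: diagram_hom_ext => x; [exact: null_space_eq..|].
by rewrite /= -es.
Qed.

Lemma quo110_epi : epimorphism quo110.
Proof.
move=> T g h e; apply: diagram_hom_ext => x; last by rewrite !from_null.
- exact: (congr1 (fun t : diagram_hom d111 _ => homU t x) e).
- exact: (congr1 (fun t : diagram_hom d111 _ => homV t x) e).
Qed.

Lemma incl010_neq0 : incl010 <> 0.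
Proof.
move=> /(congr1 (fun t : diagram_hom d010 d110 => homV t 1)) /= /eqP.
by rewrite oner_eq0.
Qed.

Lemma incl001_kernel : is_kernel (quo100 \oc quo110) incl001.
Proof.
split; first by apply: diagram_hom_ext.
move=> T t e; apply: (proj2 (factor_through_incl001 _)) => u.
exact: (congr1 (fun s : diagram_hom _ d100 => homU s u) e).
Qed.

Lemma quo110_cokernel : is_cokernel incl001 quo110.
Proof.
split; first by apply: diagram_hom_ext.
move=> T t e.
have tW (w : dW d111) : homW t w = 0.
  exact: (congr1 (fun s : diagram_hom d001 _ => homW s w) e).
have sb (v : dV d110) :
  (\0 : {linear null -> dW (sval T)}) (beta d110 v) =
  beta (sval T) (homV t v) by rewrite -homW_beta tW.
pose s : hom D110 T := @DiagramHom k d110 (sval T) (homU t) (homV t) \0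
  (homV_alpha t) sb.
have es : s \oc quo110 = t by apply: diagram_hom_ext => x //=; rewrite tW.
by exists s; split=> // r er; apply: quo110_epi; rewrite es er.
Qed.

Definition D000 : D := exist _ _ (@zero_im_plus_ker k).

Lemma zero_cokernel :
  is_cokernel (quo100 \oc quo110) (0 : hom D100 D000).
Proof.
split; first by apply: diagram_hom_ext => x; exact: null_space_eq.
move=> T t e; exists 0; split.
  apply: diagram_hom_ext => x; rewrite ?from_null ?[RHS]from_null //=.
  by rewrite -[LHS](congr1 (fun s : diagram_hom d111 _ => homU s x) e).
by move=> s _; apply: diagram_hom_ext => x; rewrite !from_null.
Qed.

Lemma idm_kernel : is_kernel (0 : hom D100 D000) (idm D100).
Proof.
split; first exact: diagram_hom_ext.
move=> T t _; exists t; split=> [|s <-]; last by rewrite comp1m.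
exact: comp1m.
Qed.

(** The canonical factor of [quo100 \oc quo110] is [quo100], since [quo110] is its
coimage and the identity its image; but [quo100] kills the nonzero
[incl010]. *)
Lemma im_plus_ker_not_left_semi_abelian : ~ left_semi_abelian D.
Proof.
move=> lsa.
have m : monomorphism quo100.
  apply: (lsa _ _ _ _ _ _ (quo100 \oc quo110) _ _ _ _ _ incl001_kernel
    zero_cokernel quo110_cokernel idm_kernel).
  by rewrite comp1m.
by apply/incl010_neq0/m; apply: diagram_hom_ext => x //=; exact: null_space_eq.
Qed.

Lemma pullback001 : is_pullback quo110 incl010 incl001 (0 : hom D001 D010).
Proof.
split; first by apply: diagram_hom_ext.
move=> T s t e.
have sU u : homU s u = 0.
  exact: (congr1 (fun r : diagram_hom _ d110 => homU r u) e).
have [sV [r [er r_uniq]]] := factor_through_incl001 sU.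
exists r; split=> [|r' [er' _]]; last exact: r_uniq.
split=> //; apply: diagram_hom_ext => x; try exact: null_space_eq.
rewrite /= -(sV x).
exact: (congr1 (fun r : diagram_hom _ d110 => homV r x) e).
Qed.

(** The zero morphism to the nonzero object [D010] is not an epimorphism: it does
not distinguish [incl010] from 0. *)
Lemma im_plus_ker_not_left_integral : ~ left_integral D.
Proof.
move=> li; have e := li _ _ _ _ _ _ _ _ pullback001 quo110_epi.
by apply/incl010_neq0/e; apply: diagram_hom_ext => x /=; rewrite ?linear0.
Qed.

End Counterexample.

Theorem mainTheorem3 (k : fieldType) :
  [/\ preabelian (im_plus_ker_category k),
      right_integral (im_plus_ker_category k),
      ~ left_semi_abelian (im_plus_ker_category k)
    & ~ left_integral (im_plus_ker_category k)].
Proof.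
split.
- exact: im_plus_ker_preabelian.
- exact: im_plus_ker_right_integral.
- exact: im_plus_ker_not_left_semi_abelian.
- exact: im_plus_ker_not_left_integral.
Qed.
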